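(* Let $G$ be a group, let $S$ be a transitive right $G$-set of prime cardinality $n$, let $F$ be a field of characteristic $0$, and let $0 \ne v \in F[S]$. Then $$t + d > n,$$ where $t = |\mathrm{supp}(v)|$ and $d = \dim_F(\langle v\rangle)$.
   Context: For a field $F$ and a right $G$-set $S$, $F[S]$ denotes the permutation module: the $F$-vector space of (finite) formal $F$-linear combinations of elements of $S$, with the right action of $G$ on $S$ extended linearly to $F[S]$. For $v\in F[S]$, $\mathrm{supp}(v)$ is the set of points of $S$ that occur with nonzero coefficient in $v$, and $\langle v\rangle$ is the $G$-submodule of $F[S]$ generated by $v$, i.e. the $F$-linear span of the translates $vg$, $g\in G$. *)

(* Defs.v *)
(* MathComp world; classical reasoning from mathcomp.classical. *)
From HB Require Import structures.
From mathcomp Require Import all_boot all_order all_algebra all_fingroup.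
From mathcomp Require Import finmap boolp classical_sets functions cardinality.

Set Implicit Arguments.
Unset Strict Implicit.
Unset Printing Implicit Defensive.

Import GRing.Theory.
Local Open Scope ring_scope.

(* [groupType] covers arbitrary, possibly infinite, groups; the actions of
   fingroup/action.v need a [finGroupType]. *)
Record is_right_action (G : groupType) (S : Type) (act : S -> G -> S) : Prop :=
  IsRightAction {
    right_act1 : forall s, act s 1%g = s;
    right_actM : forall s g h, act s (g * h)%g = act (act s g) h
  }.

Definition transitive_action (G : groupType) (S : Type) (act : S -> G -> S) :
    Prop :=
  forall s t, exists g, act s g = t.

(* F[S] for a finite S: a formal combination is its coefficient function.
   The regular module [F^o] is what makes this type a [vectType F]. *)
Definition perm_module (F : fieldType) (S : finType) : vectType F :=
  {ffun S -> F^o}.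

Section PermModule.
Variables (F : fieldType) (S : finType).
Implicit Types (v w : perm_module F S).

Definition basis_elt (s : S) : perm_module F S := [ffun u => (u == s)%:R].

Definition supp v : {set S} := [set s | v s != 0].

Lemma perm_module_sum v : v = \sum_s v s *: basis_elt s.
Proof.
apply/ffunP=> u; rewrite sum_ffunE (bigD1 u) //= big1 => [|s neq_su].
  by rewrite !ffunE eqxx addr0 /GRing.scale /= mulr1.
by rewrite !ffunE eq_sym (negPf neq_su) scaler0.
Qed.

Variables (G : groupType) (act : S -> G -> S).

Definition module_act v (g : G) : perm_module F S :=
  \sum_s v s *: basis_elt (act s g).

(* [fset_set] is meaningful only on finite sets; see [finite_translates]. *)
Definition generated_submodule v : {vspace perm_module F S} :=
  <<fset_set (range (module_act v))>>%VS.

Lemma finite_translates v : finite_set (range (module_act v)).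
Proof.
apply: (@sub_finite_set _ _
  [set` [seq \sum_s v s *: basis_elt (f s) | f : {ffun S -> S}]]%classic);
  last exact: finite_seq.
move=> _ [g _ <-] /=; apply/mapP; exists [ffun s => act s g].
  by rewrite mem_enum.
by apply: eq_bigr => s _; rewrite ffunE.
Qed.

Lemma module_act_generated v g : module_act v g \in generated_submodule v.
Proof.
apply: memv_span; rewrite in_fset_set; last exact: finite_translates.
by rewrite inE; exists g.
Qed.

Lemma generated_submodule_min v (U : {vspace perm_module F S}) :
  (forall g, module_act v g \in U) -> (generated_submodule v <= U)%VS.
Proof.
move=> vU; apply/span_subvP => w.
rewrite in_fset_set; last exact: finite_translates.
by rewrite inE => -[g _ <-].
Qed.

End PermModule.

(* Main.v *)
(* Let d be the dimension of <v>. By Cauchy's theorem some g in G acts on S as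
   an n-cycle, which identifies S with Z/n and v with a polynomial f of degree
   < n having t = |supp v| terms. The d + 1 translates v g^k, k <= d, are
   dependent: for some q != 0 of degree <= d, q * f vanishes at every n-th root
   of unity, so f vanishes at all but at most d of them. If t + d <= n, then f
   has as many n-th roots of unity among its roots as it has terms, which in
   characteristic 0 forces f = 0 (Chebotarev's theorem on the minors of the
   Fourier matrix).
   For the latter, reduce the t monomials X^e of f modulo the product of the t
   factors X - x^j attached to the roots z^j, over Z[x]. The coefficients form a
   square matrix over Z[x] with determinant E(x). At x = 1 and modulo n the
   product becomes (X - 1)^t, which divides no nonzero t-term polynomial of
   degree < n over F_n; so n does not divide E(1). As 1 - z generates a prime
   above n, E(z) != 0, and f = 0 follows. *)
Require Import Defs.
From HB Require Import structures.
From mathcomp Require Import all_boot all_order all_algebra all_fingroup.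
From mathcomp Require Import pgroup fieldext.
From mathcomp Require Import boolp.
From mathcomp Require Import ring.

Set Implicit Arguments.
Unset Strict Implicit.
Unset Printing Implicit Defensive.

Import GRing.Theory.
Local Open Scope ring_scope.

(** * Sums of monomials, and sparse polynomials in characteristic p *)

Lemma coef_sum_monom (R : nzRingType) (I : finType) (e : I -> nat) (c : I -> R)
    i :
  injective e -> (\sum_j c j *: 'X^(e j))`_(e i) = c i.
Proof.
move=> e_inj; rewrite coef_sum (bigD1 i) //= big1 => [|j neq_ji].
  by rewrite coefZ coefXn eqxx mulr1 addr0.
by rewrite coefZ coefXn (inj_eq e_inj) eq_sym (negPf neq_ji) mulr0.
Qed.

Lemma coef_sum_monom0 (R : nzRingType) (I : finType) (e : I -> nat) (c : I -> R)
    k :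
  (forall j, k != e j) -> (\sum_j c j *: 'X^(e j))`_k = 0.
Proof.
move=> ke; rewrite coef_sum big1 // => j _.
by rewrite coefZ coefXn (negPf (ke j)) mulr0.
Qed.

Lemma size_sum_monom (R : nzRingType) (I : finType) (e : I -> nat) (c : I -> R)
    m :
  (forall j, e j < m)%N -> (size (\sum_j c j *: 'X^(e j))%R <= m)%N.
Proof.
move=> em; apply/leq_sizeP => k le_mk; apply: coef_sum_monom0 => j.
by rewrite gtn_eqF // (leq_trans (em j)).
Qed.

Lemma eqr_nat_pchar (K : fieldType) (p i j : nat) : p \in [pchar K] ->
  (i < p)%N -> (j < p)%N -> (i%:R == j%:R :> K) = (i == j).
Proof.
move=> pK; wlog le_ij : i j / (i <= j)%N => [th|] ip jp.
  by case/orP: (leq_total i j) => h; [|rewrite eq_sym (eq_sym i)]; exact: th.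
rewrite eq_sym -subr_eq0 -natrB // -(dvdn_pcharf pK) -eqn_mod_dvd //.
by rewrite !modn_small // eq_sym.
Qed.

(** Induction on [t]: for [k] the degree of [g], the operator below kills the leading term and
    lowers the multiplicity of the root 1 by at most one. If its value [h] is 0, then [g] is a
    monomial, because i - k is nonzero in [K] for distinct i, k < p; but a nonzero monomial does not
    vanish at 1. *)
Lemma sparse_pchar_eq0 (K : fieldType) (p t : nat) (g : {poly K}) :
    p \in [pchar K] -> (size g <= p)%N ->
    (#|[set i : 'I_p | (g`_i != 0)%R]| <= t)%N -> ('X - 1) ^+ t %| g ->
  g = 0.
Proof.
move=> pK; elim: t g => [|t IHt] g size_g.
  rewrite leqn0 cards_eq0 => /eqP g0 _; apply/polyP=> i; rewrite coef0.
  have [/(leq_trans size_g)|ltip] := leqP p i; first by move/leq_sizeP->.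
  by have /setP/(_ (Ordinal ltip)) := g0; rewrite !inE => /negbFE/eqP.
move=> supp_g div_g; apply/eqP/negPn/negP => gN0.
pose k := (size g).-1; have gk : g`_k != 0 by rewrite -lead_coefE lead_coef_eq0.
have ltkp : (k < p)%N by rewrite /k prednK // size_poly_gt0.
(* The operator X d/dX - k multiplies the i-th coefficient by i - k. *)
pose h := 'X * g^`() - k%:R *: g.
have hE i : h`_i = (i%:R - k%:R) * g`_i.
  rewrite coefB coefXM coefZ coef_deriv mulrBl; case: i => [|i] /=.
    by rewrite mul0r sub0r.
  by rewrite !mulr_natl.
have h0 : h = 0.
  apply: IHt.
  - by apply/leq_sizeP => i lepi; rewrite hE (leq_sizeP _ _ size_g) ?mulr0.
  - rewrite -ltnS; apply: leq_trans supp_g.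
    apply/proper_card/properP; split.
      by apply/subsetP=> i; rewrite !inE hE mulf_eq0 negb_or => /andP[].
    by exists (Ordinal ltkp); rewrite !inE ?hE //= subrr mul0r eqxx.
  - have /dvdpP[q gE] := div_g.
    apply: dvdp_sub; last first.
      by rewrite -mul_polyC dvdp_mull // (dvdp_trans _ div_g) // exprS dvdp_mull.
    rewrite dvdp_mull // gE derivM deriv_exp dvdp_add ?dvdp_mull //=.
      by rewrite exprS dvdp_mull.
    by rewrite -mulr_natl !dvdp_mull.
have gE : g = g`_k *: 'X^k.
  apply/polyP=> i; rewrite coefZ coefXn; have [->|neq_ik] := eqVneq i k.
    by rewrite mulr1.
  have [/(leq_trans size_g)|ltip] := leqP p i.
    by move/leq_sizeP->; rewrite ?mulr0.
  have /polyP/(_ i) := h0; rewrite hE coef0 mulr0 => /eqP; rewrite mulf_eq0.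
  by rewrite subr_eq0 (eqr_nat_pchar pK) // (negPf neq_ik) => /eqP.
have : root g 1.
  rewrite -dvdp_XsubCl (dvdp_trans _ div_g) // exprS dvdp_mulr //.
by rewrite gE /root hornerZ hornerXn expr1n mulr1 (negPf gk).
Qed.

(** * Remainders of monomials modulo a product of linear factors *)

Section Remainders.
Variables (t : nat) (e J : 'I_t -> nat).

(** The inner variable x stands for a root of unity: a single matrix over Z[x] can then be
    specialised both at 1 in F_p and at [z] in a field of characteristic 0. *)
Definition rem_divisor : {poly {poly int}} :=
  \prod_(b < t) ('X - ('X^(J b))%:P).
Definition rem_mx : 'M[{poly int}]_t :=
  \matrix_a poly_rV (Pdiv.Ring.rmodp 'X^(e a) rem_divisor).

Lemma monic_rem_divisor : rem_divisor \is monic.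
Proof. by apply: monic_prod => b _; apply: monicXsubC. Qed.

Variables (K : fieldType) (phi : {rmorphism {poly int} -> K}).
Let M := map_poly phi rem_divisor.

Lemma map_rem_divisor : M = \prod_(b < t) ('X - (phi 'X ^+ J b)%:P).
Proof.
rewrite /M rmorph_prod; apply: eq_bigr => b _ /=.
by rewrite rmorphB /= map_polyX map_polyC /= rmorphXn.
Qed.

(** Division by a monic polynomial commutes with the change of coefficients [phi]. *)
Lemma modp_rem_mx (c : 'rV[K]_t) :
  (\sum_a c 0 a *: 'X^(e a)) %% M = rVpoly (c *m map_mx phi rem_mx).
Proof.
pose Q a := Pdiv.Ring.rdivp 'X^(e a) rem_divisor.
pose R a := Pdiv.Ring.rmodp 'X^(e a) rem_divisor.
have sizeM : size M = t.+1.
  by rewrite map_rem_divisor size_prod_XsubC /index_enum -enumT size_enum_ord.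
have sizeR a : (size (map_poly phi (R a)) <= t)%N.
  have := Pdiv.Ring.ltn_rmodpN0 'X^(e a) (monic_neq0 monic_rem_divisor).
  rewrite [in leqRHS]size_prod_XsubC /index_enum -enumT size_enum_ord ltnS.
  by apply: leq_trans; apply: size_poly.
have -> : rVpoly (c *m map_mx phi rem_mx) = \sum_a c 0 a *: map_poly phi (R a).
  rewrite mulmx_sum_row linear_sum; apply: eq_bigr => a _.
  by rewrite linearZ -map_row rowK map_poly_rV /= poly_rV_K // sizeR.
have -> : \sum_a c 0 a *: 'X^(e a) =
    (\sum_a c 0 a *: map_poly phi (Q a)) * M +
    \sum_a c 0 a *: map_poly phi (R a).
  rewrite mulr_suml -big_split; apply: eq_bigr => a _ /=.
  rewrite -scalerAl -scalerDr -rmorphM -rmorphD.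
  by rewrite -Pdiv.RingMonic.rdivp_eq ?monic_rem_divisor //= map_polyXn.
rewrite modp_addl_mul_small // sizeM ltnS.
apply: (leq_trans (size_sum _ _ _)); apply/bigmax_leqP => a _.
exact: leq_trans (size_scale_leq _ _) (sizeR a).
Qed.

(** The left kernel of the specialised matrix consists of the [c] whose combination of monomials has
    remainder 0 modulo [M]. *)
Lemma det_rem_mx_neq0P :
  reflect (forall c : 'rV[K]_t, M %| \sum_a c 0 a *: 'X^(e a) -> c = 0)
          (phi (\det rem_mx) != 0).
Proof.
rewrite -det_map_mx; apply: (iffP idP).
  move=> det_neq0 c /eqP; rewrite modp_rem_mx => /(congr1 (@poly_rV _ t)).
  rewrite rVpolyK linear0 => cN0; apply: contraNeq det_neq0 => cN.
  by apply/det0P; exists c.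
move=> inj; apply/det0P => -[c /eqP cN cN0]; apply: cN; apply: inj.
by rewrite /dvdp modp_rem_mx cN0 linear0.
Qed.
End Remainders.


(** * Algebraic integers and divisibility by p *)

Lemma intr_eq0_pchar0 (K : fieldType) (c : int) : [pchar K] =i pred0 ->
  (c%:~R == 0 :> K) = (c == 0).
Proof.
move=> /pcharf0P K0; case: c => n; first by rewrite -pmulrn K0.
by rewrite NegzE rmorphN /= oppr_eq0 -pmulrn K0.
Qed.

(** Multiplying the monic equation of b = c/p, of degree m, by p^m leaves c^m plus terms divisible
    by p. *)
Lemma dvdz_integral (K : fieldType) (p : nat) (c : int) (b : K) :
    [pchar K] =i pred0 -> prime p -> integralOver (intr : int -> K) b ->
    p%:R * b = c%:~R ->
  (p %| c)%Z.
Proof.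
move=> K0 p_pr [q monq qb0] pbE; pose m := (size q).-1.
have sizeq : size q = m.+1 by rewrite prednK // size_poly_gt0 monic_neq0.
have qm1 : q`_m = 1 by apply/monicP: monq.
have: \sum_(i < m.+1) q`_i * c ^+ i * p%:Z ^+ (m - i) = 0.
  apply/eqP; rewrite -(intr_eq0_pchar0 _ K0).
  suff -> : (\sum_(i < m.+1) q`_i * c ^+ i * p%:Z ^+ (m - i))%:~R =
      p%:R ^+ m * (map_poly intr q).[b] by rewrite (rootP qb0) mulr0.
  rewrite horner_coef size_map_poly_id0 ?(monicP monq) ?oner_neq0 // sizeq.
  rewrite mulr_sumr rmorph_sum; apply: eq_bigr => i _ /=.
  rewrite coef_map /= !rmorphM !rmorphXn /= -pbE exprMn.
  have -> : p%:R ^+ m = p%:R ^+ (m - i) * p%:R ^+ i :> K.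
    by rewrite -exprD subnK ?leq_ord.
  by rewrite -pmulrn; ring.
rewrite big_ord_recr /= qm1 mul1r subnn mulr1 => /eqP.
rewrite addrC addr_eq0 => /eqP cmE.
suff: (p %| c ^+ m)%Z by rewrite !dvdzE abszX /= Euclid_dvdX // => /andP[].
rewrite cmE rpredN; apply: rpred_sum => i _.
by rewrite dvdz_mull // -(subnSK (ltn_ord i)) exprS dvdz_mulr.
Qed.

Lemma map_intr_Fp_eq0 (p : nat) (f : {poly int}) : prime p ->
  map_poly (intr : int -> 'F_p) f = 0 -> exists B, f = p%:Z *: B.
Proof.
move=> p_pr f0; exists (map_poly (fun x => x %/ p)%Z f); apply/polyP=> i.
rewrite coefZ coef_map_id0 ?div0z // mulrC divzK //.
rewrite (dvdz_pcharf (pchar_Fp p_pr)).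
by have /polyP/(_ i) := f0; rewrite coef_map coef0 => ->.
Qed.

(* E^p and E(1)^p + Q^p (X^p - 1), where E = E(1) + Q (X - 1), agree modulo p;
   at z this makes E(1)^p equal to p times an algebraic integer. *)
Lemma dvdz_horner1_root_unity (K : fieldType) (p : nat) (z : K)
    (E : {poly int}) :
    [pchar K] =i pred0 -> prime p -> z ^+ p = 1 -> root (map_poly intr E) z ->
  (p %| E.[1])%Z.
Proof.
move=> K0 p_pr zp1 Ez0.
have [Q QE] : exists Q, E - (E.[1])%:P = Q * ('X - 1%:P).
  by apply/factor_theorem; rewrite /root !hornerE subrr.
have pFp : p \in [pchar {poly 'F_p}] by rewrite pchar_poly pchar_Fp.
have [B BE] : exists B,
    E ^+ p - (E.[1])%:P ^+ p - Q ^+ p * ('X^p - 1) = p%:Z *: B.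
  apply: map_intr_Fp_eq0 => //; move: (E.[1]) QE => c /(canRL (subrK _)) ->.
  rewrite !(rmorphB, rmorphM, rmorphD, rmorphXn) /= map_polyX !rmorph1.
  have -> : 'X^p - 1 = ('X - 1) ^+ p :> {poly 'F_p}.
    by rewrite -!(pFrobenius_autE pFp) rmorphB rmorph1.
  by rewrite -!(pFrobenius_autE pFp) rmorphD rmorphM /= addrK subrr.
suff: (p %| E.[1] ^+ p)%Z.
  by rewrite !dvdzE abszX /= Euclid_dvdX // => /andP[].
(* -B(z) is integral, as [z] is a root of X^p - 1, and [BE] evaluated at [z] reads p * (-B(z)) =
   E(1)^p. *)
apply: (@dvdz_integral K _ _ (- (map_poly intr B).[z])) => //.
  apply/integral_opp/integral_horner.
    by apply/integral_poly => i; rewrite coef_map; apply: integral_id.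
  exists ('X^p - 1); first by rewrite monicXnsubC // prime_gt0.
  by rewrite rmorphB /= map_polyXn rmorph1 /root !hornerE zp1 subrr.
have /(congr1 (fun r => (map_poly (intr : int -> K) r).[z])) := BE.
rewrite -mul_polyC !(rmorphB, rmorphM, rmorphXn) /= map_polyX !map_polyC rmorph1.
rewrite !(hornerE, horner_exp) (rootP Ez0) zp1 subrr mulr0 subr0.
rewrite expr0n (gtn_eqF (prime_gt0 p_pr)) sub0r mulrN pmulrn => <-.
by rewrite opprK.
Qed.

(** * Sparse polynomials vanishing at p-th roots of unity *)

Lemma sparse_unity_roots_eq0 (K : fieldType) (p : nat) (z : K) (f : {poly K})
    (rs : seq K) :
    [pchar K] =i pred0 -> prime p -> p.-primitive_root z -> (size f <= p)%N ->
    uniq rs -> all p.-unity_root rs -> all (root f) rs ->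
    (#|[set i : 'I_p | (f`_i != 0)%R]| <= size rs)%N ->
  f = 0.
Proof.
move=> K0 p_pr z_prim size_f uniq_rs rs1 f_rs.
set A := [set i : 'I_p | _]; set t := #|A| => le_t.
pose e (a : 'I_t) : nat := @enum_val _ (mem A) a.
(* Only the first [t] roots of [rs] are used, as many as there are terms, so that the matrix of
   remainders is square. *)
have le_rs (b : 'I_t) : (b < size rs)%N by apply: leq_trans le_t.
have [J JE] : exists J : 'I_t -> nat, forall b : 'I_t, rs`_b = z ^+ J b.
  have ex (b : 'I_t) : exists j, rs`_b == z ^+ j.
    have /unity_rootP/(prim_rootP z_prim)[j ->] := allP rs1 _ (mem_nth 0 (le_rs b)).
    by exists j.
  by exists (fun b => xchoose (ex b)) => b; apply/eqP; exact: (xchooseP (ex b)).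
have e_inj : injective e by move=> a b /val_inj /enum_val_inj.
pose phi (L : fieldType) (x : L) : {rmorphism {poly int} -> L} :=
  horner_eval x \o map_poly (intr : int -> L).
have phiX L x : phi L x 'X = x.
  by rewrite /phi /= map_polyX horner_evalE hornerX.
(* At x = 1 every factor becomes X - 1, so a kernel vector gives a polynomial with at most [t] terms
   divisible by (X - 1)^t. *)
have detFp : phi 'F_p 1 (\det (rem_mx e J)) != 0.
  apply/det_rem_mx_neq0P => c; rewrite map_rem_divisor.
  under eq_bigr do rewrite phiX expr1n.
  rewrite prodr_const card_ord => dvd_g; apply/rowP => a.
  rewrite mxE -(coef_sum_monom (c 0) a e_inj).
  rewrite (sparse_pchar_eq0 (pchar_Fp p_pr) _ _ dvd_g) ?coef0 //.
    by apply: size_sum_monom => b; apply: ltn_ord.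
  apply/subset_leq_card/subsetP=> i; rewrite inE; apply: contraR => iA.
  apply/eqP/coef_sum_monom0 => b; apply: contraNneq iA => ib.
  by rewrite (val_inj ib) enum_valP.
(* Were the determinant to vanish at [z], p would divide its value at 1, against [detFp]. *)
have detK : phi K z (\det (rem_mx e J)) != 0.
  have zp1 := prim_expr_order z_prim.
  apply: contraNN detFp => /(dvdz_horner1_root_unity K0 p_pr zp1).
  rewrite (dvdz_pcharf (pchar_Fp p_pr)) -horner_map rmorph1; exact.
have fE : f = \sum_a (\row_b f`_(e b)) 0 a *: 'X^(e a).
  apply/polyP => i; have [[a ->]|Nex] := pselect (exists a, i = e a).
    by rewrite coef_sum_monom // mxE.
  rewrite coef_sum_monom0 => [|a]; last by apply/eqP => ia; case: Nex; exists a.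
  have [/(leq_trans size_f)|ltip] := leqP p i; first by move/leq_sizeP->.
  apply/eqP/negPn/negP => fi; apply: Nex.
  have iA : Ordinal ltip \in A by rewrite inE.
  by exists (enum_rank_in iA (Ordinal ltip)); rewrite /e enum_rankK_in.
have c0 : (\row_b f`_(e b)) = 0 :> 'rV_t.
  apply: (elimT (det_rem_mx_neq0P _ _ _) detK); rewrite -fE map_rem_divisor.
  under eq_bigr do rewrite phiX -JE.
  rewrite -(big_map (fun b : 'I_t => rs`_b) xpredT (fun x => 'X - x%:P)).
  apply: uniq_roots_dvdp.
    by apply/allP => _ /mapP[b _ ->]; apply: (allP f_rs); rewrite mem_nth.
  rewrite uniq_rootsE map_inj_uniq ?index_enum_uniq // => b c /eqP.
  by rewrite nth_uniq // => /eqP/val_inj.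
by rewrite fE c0 big1 // => a _; rewrite mxE scale0r.
Qed.

(** * Adjoining a primitive p-th root of unity *)

Lemma exists_root_ext (F : fieldType) (q : {poly F}) : (1 < size q)%N ->
  exists (L : fieldExtType F) (z : L), root (map_poly (in_alg L) q) z.
Proof.
have [m] := ubnP (size q); elim: m q => // m IHm q le_qm q_gt1.
have [/irredp_FAdjoin[L _ [z qz _]]|red_q] := pselect (irreducible_poly q).
  by exists L, z.
(* Otherwise [q] has a proper nonconstant factor, and a root of that factor is a root of [q]. *)
have [d [d_neq1 d_q d_neqq]] :
    exists d : {poly F}, [/\ size d != 1%N, d %| q & ~~ (d %= q)].
  apply: contrapT => Nd; apply: red_q; split=> // d d1 dq.
  by apply/negPn/negP => dNq; apply: Nd; exists d.
have q_neq0 : q != 0 by rewrite -size_poly_gt0 ltnW.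
have [||L [z dz]] := IHm d.
- rewrite -ltnS; apply: leq_trans le_qm; rewrite ltnS ltn_neqAle dvdp_leq //.
  by rewrite dvdp_size_eqp // d_neqq.
- by rewrite ltn_neqAle eq_sym d_neq1 size_poly_gt0 (dvdpN0 d_q).
exists L, z; move: dz; rewrite -!dvdp_XsubCl => /dvdp_trans -> //.
by rewrite dvdp_map.
Qed.

(** A root z of 1 + X + ... + X^(p-1) satisfies z^p = 1, so its order is 1 or p; z = 1 would make p
    vanish in [L]. *)
Lemma exists_prim_root_ext (F : fieldType) (p : nat) :
  [pchar F] =i pred0 -> prime p ->
  exists (L : fieldExtType F) (z : L), p.-primitive_root z.
Proof.
move=> F0 p_pr; have p_gt0 := prime_gt0 p_pr.
have [|L [z]] := @exists_root_ext F (\poly_(i < p) 1).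
  by rewrite size_poly_eq ?prime_gt1 ?oner_neq0.
rewrite poly_def rmorph_sum /root horner_sum => /eqP.
under eq_bigr do rewrite scale1r /= map_polyXn hornerXn.
move=> sum_z; exists L, z.
have [m z_prim m_p] : {m | m.-primitive_root z & (m %| p)%N}.
  apply: prim_order_exists => //; apply/eqP.
  by rewrite -subr_eq0 subrX1 sum_z mulr0.
have /primeP[_ /(_ m m_p)/pred2P[m1|<-//]] := p_pr.
have z1 : z = 1 by have := prim_expr_order z_prim; rewrite m1.
have /pcharf0P/(_ p) : [pchar L] =i pred0.
  by move=> i; rewrite -(F0 i); apply: (fmorph_pchar (in_alg L)).
have -> : p%:R = 0 :> L.
  rewrite -sum_z z1; under eq_bigr do rewrite expr1n.
  by rewrite sumr_const card_ord.
by rewrite eqxx (gtn_eqF p_gt0).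
Qed.

(** * A group element acting as an n-cycle *)

Lemma prime_transitive_cycle (G : groupType) (S : finType) (act : S -> G -> S)
    (n : nat) :
    is_right_action act -> transitive_action act -> #|S| = n -> prime n ->
  exists (g : G) (ix : S -> 'I_n),
    injective ix /\ forall u, ix (act u g) = ((ix u).+1 %% n)%N :> nat.
Proof.
move=> [act1 actM] act_trans cardS n_pr; have n_gt0 := prime_gt0 n_pr.
have act_inj g : injective (act^~ g).
  by apply: (can_inj (g := act^~ g^-1%g)) => x; rewrite -actM mulgV act1.
(* [G] may be infinite, so Cauchy's theorem is applied to its image in the symmetric group of [S],
   whose order n divides by transitivity. *)
pose H := [set s : {perm S} | `[< exists g, forall x, s x = act x g >]].
have H_group : group_set H.
  apply/group_setP; split.
    by rewrite inE; apply/asboolP; exists 1%g => x; rewrite perm1 act1.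
  move=> s r; rewrite !inE => /asboolP[g sg] /asboolP[h rh]; apply/asboolP.
  by exists (g * h)%g => x; rewrite permM sg rh actM.
have [x1 _] : exists x1, x1 \in S by apply/card_gt0P; rewrite cardS.
have H_trans : [transitive Group H_group, on [set: S] | 'P].
  apply/imsetP; exists x1 => //; apply/setP => y; rewrite inE.
  apply/esym/orbitP.
  have [g <-] := act_trans x1 y; exists (perm (act_inj g)).
    by rewrite inE; apply/asboolP; exists g => x; rewrite permE.
  by rewrite /= apermE permE.
have := atrans_dvd H_trans; rewrite cardsT cardS => /(Cauchy n_pr)[s].
rewrite inE => /asboolP[g sg] s_ord.
have [x0 sx0] : exists x0, s x0 != x0.
  apply/existsP; apply: contraLR (prime_gt1 n_pr) => /existsPn s_id.
  rewrite -s_ord; suff -> : s = 1%g by rewrite order1.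
  by apply/permP => x; rewrite perm1; apply/eqP/negPn.
(* The orbit of the moved point [x0] has size dividing the prime n, and is not a single point. *)
have s_full y : y \in porbit s x0.
  have : (#|porbit s x0| %| n)%N.
    by rewrite -s_ord porbitE; apply: (dvdn_orbit 'P <[s]> x0).
  have /primeP[_ dvd_n] := n_pr => /dvd_n/pred2P[/eqP/cards1P[x xE]|card_n].
    have := mem_porbit s 1 x0; have := porbit_id s x0.
    by rewrite xE !inE expg1 => /eqP <- sx; rewrite sx in sx0.
  suff /eqP -> : porbit s x0 == setT by rewrite inE.
  by rewrite eqEcard subsetT cardsT cardS card_n /=.
have modE i : (s ^+ (i %% n) = s ^+ i)%g by rewrite -s_ord expg_mod_order.
(* [ix u] is the position of [u] on the cycle, counted from [x0]. *)
have [ix ixE] : exists ix : S -> 'I_n, forall u, u = (s ^+ ix u)%g x0.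
  have ex u : exists i : 'I_n, u == (s ^+ i)%g x0.
    have /porbitP[i ->] := s_full u; exists (Ordinal (ltn_pmod i n_gt0)) => /=.
    by rewrite modE.
  by exists (fun u => xchoose (ex u)) => u; apply/eqP; exact: (xchooseP (ex u)).
have ix_inj : injective ix by move=> u w uw; rewrite (ixE u) uw -ixE.
have [x ixK xK] : bijective ix by apply: inj_card_bij; rewrite // card_ord cardS.
have xE i : x i = (s ^+ i)%g x0 by rewrite {1}(ixE (x i)) xK.
exists g, ix; split=> // u.
have -> : act u g = x (Ordinal (ltn_pmod (ix u).+1 n_gt0)).
  by rewrite xE modE expgSr permM -ixE sg.
by rewrite xK.
Qed.

(** * The bound, by counting the n-th roots of unity where f vanishes *)

Theorem theoremE (G : groupType) (S : finType) (act : S -> G -> S) (n : nat)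
    (F : fieldType) (v : perm_module F S)
    (act_right : is_right_action act) (act_trans : transitive_action act)
    (card_S : #|S| = n) (n_prime : prime n)
    (char_F : [pchar F] =i pred0) (v_neq0 : v != 0) :
  (n < #|supp v| + \dim (generated_submodule act v))%N.
Proof.
have [g [ix [ix_inj ix_g]]] :=
  prime_transitive_cycle act_right act_trans card_S n_prime.
have [L [z z_prim]] := exists_prim_root_ext char_F n_prime.
have L0 : [pchar L] =i pred0.
  by move=> i; rewrite -(char_F i); apply: (fmorph_pchar (in_alg L)).
set d := \dim _; rewrite ltnNge; apply/negP => le_tdn.
pose V k := module_act act v (g ^+ k)%g.
have [c c0 [k0 ck0]] : exists2 c : 'I_d.+1 -> F,
    \sum_k c k *: V k = 0 & exists k, c k != 0.
  have : ~~ free [tuple V k | k < d.+1].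
    apply/negP => /eqnP; rewrite size_tuple => dimV.
    suff : (d.+1 <= d)%N by rewrite ltnn.
    rewrite -[X in (X <= _)%N]dimV; apply/dimvS/span_subvP => _ /mapP[k _ ->].
    exact: module_act_generated.
  move=> /freeP Nfree; apply: contrapT => Nc; apply: Nfree => c cV i.
  apply/eqP/negPn/negP => ci; apply: Nc; exists c; last by exists i.
  by rewrite -[RHS]cV; apply: eq_bigr => k _; rewrite -tnth_nth tnth_mktuple.
(* [ev x w] is the value at x of the polynomial attached to [w]. Acting by [g] shifts exponents
   modulo n, hence multiplies this value by x when x^n = 1. *)
pose ev (x : L) (w : perm_module F S) := \sum_u (w u)%:A * x ^+ ix u.
have ev_sum x (I : finType) (a : I -> F) (W : I -> perm_module F S) :
    ev x (\sum_i a i *: W i) = \sum_i (a i)%:A * ev x (W i).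
  under [RHS]eq_bigr do rewrite mulr_sumr.
  rewrite exchange_big; apply: eq_bigr => u _ /=.
  rewrite sum_ffunE scaler_suml mulr_suml; apply: eq_bigr => i _.
  by rewrite ffunE mulrA [in RHS]mulr_algl scalerA.
have ev_act x k : x ^+ n = 1 -> ev x (V k) = x ^+ k * ev x v.
  move=> xn; rewrite ev_sum mulr_sumr; apply: eq_bigr => s _.
  rewrite mulrCA; congr (_ * _); rewrite /ev (bigD1 (act s (g ^+ k)%g)) //= big1.
    rewrite ffunE eqxx scale1r mul1r addr0; case: act_right => act1 actM.
    elim: k => [|k IHk]; first by rewrite expg0 act1 mul1r.
    by rewrite expgSr actM ix_g expr_mod // exprS IHk exprS mulrA.
  by move=> u us; rewrite ffunE (negPf us) scale0r mul0r.
pose q : {poly L} := \sum_(k < d.+1) (c k)%:A *: 'X^k.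
have q_ev x : x ^+ n = 1 -> q.[x] * ev x v = 0.
  move=> xn; rewrite horner_sum mulr_suml -[RHS](_ : ev x 0 = 0); last first.
    by rewrite /ev big1 // => u _; rewrite ffunE scale0r mul0r.
  rewrite -c0 ev_sum; apply: eq_bigr => k _.
  by rewrite ev_act // hornerZ hornerXn mulrA.
have q_neq0 : q != 0.
  apply: contraNneq ck0 => /polyP/(_ k0).
  rewrite coef_sum_monom ?coef0; last exact: val_inj.
  by move/eqP; rewrite scaler_eq0 oner_eq0 orbF.
have size_q : (size q <= d.+1)%N by apply: size_sum_monom.
pose f : {poly L} := \sum_u (v u)%:A *: 'X^(ix u).
have ixn_inj : injective (fun u => ix u : nat) by move=> u w /val_inj/ix_inj.
have f_ev x : f.[x] = ev x v.
  by rewrite horner_sum; apply: eq_bigr => u _; rewrite hornerZ hornerXn.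
pose rs := [seq z ^+ i | i <- iota 0 n].
have rs1 x : x \in rs -> x ^+ n = 1.
  by case/mapP=> i _ ->; rewrite exprAC (prim_expr_order z_prim) expr1n.
have uniq_rs : uniq rs.
  rewrite map_inj_in_uniq ?iota_uniq // => i j; rewrite !mem_iota /= => i_n j_n.
  by move/eqP; rewrite (eq_prim_root_expr z_prim) !modn_small // => /eqP.
(* Where [f] does not vanish, [q] must, and [q] has at most [d] roots. *)
have le_nonroots : (count (predC (root f)) rs <= d)%N.
  rewrite -ltnS; apply: leq_trans size_q; rewrite -size_filter.
  apply: max_poly_roots => //; last exact: filter_uniq.
  apply/allP => x; rewrite mem_filter => /andP[/= fx /rs1 xn].
  by move/eqP: (q_ev x xn); rewrite mulf_eq0 -f_ev (negPf fx : _ == _ = _) orbF.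
have f0 : f = 0.
  apply: (@sparse_unity_roots_eq0 L n z f (filter (root f) rs)) => //.
  - exact: size_sum_monom.
  - exact: filter_uniq.
  - apply/allP => x; rewrite mem_filter => /andP[_ /rs1 xn].
    exact/unity_rootP.
  - exact: filter_all.
  (* The exponents of [f] lie in the image of the support under [ix]; and at least n - d >= t of the
     n-th roots of unity are roots of [f]. *)
  - apply: (@leq_trans #|supp v|); last first.
      rewrite size_filter -(leq_add2r d) (leq_trans le_tdn) //.
      rewrite -[n](size_iota 0) -(size_map (GRing.exp z)).
      by rewrite -(count_predC (root f)) leq_add2l.
    apply: leq_trans (leq_imset_card ix _); apply/subset_leq_card/subsetP => i.
    rewrite inE; apply: contraR => i_supp.
    have [[u iu]|Nex] := pselect (exists u, i = ix u).
      rewrite iu coef_sum_monom // scaler_eq0 oner_eq0 orbF.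
      by apply: contraNT i_supp => vu; rewrite iu imset_f // inE.
    apply/eqP/coef_sum_monom0 => u; apply/eqP => /val_inj iu.
    by apply: Nex; exists u.
case/eqP: v_neq0; apply/ffunP => u; rewrite ffunE.
have /polyP/(_ (ix u)) := f0; rewrite coef_sum_monom // coef0 => /eqP.
by rewrite scaler_eq0 oner_eq0 orbF => /eqP.
Qed.
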